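(* Let $A\in\mathbb{R}^{n\times n}$ be a nonsingular matrix with $\|A^{-1}\|<1$, let $b\in\mathbb{R}^n$, and let $\rho_1,\rho_2,\gamma>0$, $\lambda_1\in(0,1)$, $\lambda_2\in(1,+\infty)$. Assume that $x^*$ is the unique solution of the system of absolute value equations $Ax-|x|-b=0$. Then $x^*$ is the globally fixed-time stable equilibrium point of the dynamical system $$\frac{dx}{dt}=\rho(x)\,g(\gamma,x)$$ (with $\rho$ and $g$ as defined in the context), with the settling-time satisfying, for every initial condition $x(0)=x_0\in\mathbb{R}^n$, $$T(x_0)\le T_{\max}=\frac{1}{c_1(1-\kappa_1)}+\frac{1}{c_2(\kappa_2-1)},$$ where $$c_1=\frac{2^{\frac{\lambda_1-1}{2}}\gamma\rho_1\mu^2}{(L_1+L_2)^{3-\lambda_1}}>0,\qquad c_2=\frac{2^{\frac{\lambda_2-1}{2}}\gamma\rho_2\mu^{1+\lambda_2}}{(L_1+L_2)^{1+\lambda_2}}>0,$$ $$\kappa_1=\frac{\lambda_1+1}{2}\in(0.5,1),\qquad \kappa_2=\frac{\lambda_2+1}{2}\in(1,+\infty),$$ and $L_1=\|A+I\|$, $L_2=\|A-I\|$, $\mu=\sigma_{\min}(A)^2-1>0$.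
   Context: For $x\in\mathbb{R}^n$, $|x|$ denotes the componentwise absolute value. $\|\cdot\|$ is the Euclidean norm on vectors and the spectral norm on matrices; $\sigma_{\min}(A)$ is the smallest singular value of $A$; $I$ is the identity matrix. Define $r(x)=Ax-|x|-b$, $\mathbf{Fix}(r)=\{x\in\mathbb{R}^n: r(x)=0\}$, and $$g(\gamma,x)=\gamma A^\top(b+|x|-Ax)=-\gamma A^\top r(x),$$ $$\rho(x)=\begin{cases}\dfrac{\rho_1}{\|r(x)\|^{1-\lambda_1}}+\dfrac{\rho_2}{\|r(x)\|^{1-\lambda_2}}, & x\notin \mathbf{Fix}(r),\\[2mm] 0, & x\in\mathbf{Fix}(r).\end{cases}$$ For an autonomous system $\frac{dx}{dt}=f(x(t))$, $x(0)=x_0\in\mathbb{R}^n$, with $f:\mathbb{R}^n\to\mathbb{R}^n$, $x(t;x_0)$ denotes the solution with initial value $x_0$. A point $x^*$ is an equilibrium point if $f(x^* )=0$. An equilibrium point $x^*$ is globally finite-time stable if it is globally asymptotically stable and any solution $x(t;x_0)$ reaches $x^*$ at some finite time moment, i.e. $x(t;x_0)=x^*$ for all $t\ge T(x_0)$, where $T:\mathbb{R}^n\to\mathbb{R}_+$ (nonnegative reals) is called the settling-time function. It is globally fixed-time stable if it is globally finite-time stable and the settling-time function is bounded by some positive number $T_{\max}$, i.e. $T(x_0)\le T_{\max}$ for all $x_0\in\mathbb{R}^n$. *)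

(* Defs.v *)
From mathcomp Require Import all_boot all_order all_algebra.
From mathcomp Require Import all_classical all_reals all_analysis.

Set Implicit Arguments.
Unset Strict Implicit.
Unset Printing Implicit Defensive.

Import Order.TTheory GRing.Theory Num.Theory.
Import numFieldNormedType.Exports.

Local Open Scope classical_set_scope.
Local Open Scope ring_scope.

(* The norm `|x| that MathComp-Analysis puts on matrices is the maximum of the
   absolute values of the entries, hence the explicit Euclidean norm. *)
Definition norm2 (R : realType) (n : nat) (x : 'cV[R]_n) : R :=
  Num.sqrt (\sum_i x i 0 ^+ 2).

(* Operator norm induced by norm2. *)
Definition spectral_norm (R : realType) (n : nat) (A : 'M[R]_n) : R :=
  sup [set norm2 (A *m x) | x in [set x : 'cV[R]_n | norm2 x = 1]].

Definition singular_values (R : realType) (n : nat) (A : 'M[R]_n) : set R :=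
  [set s | 0 <= s /\ eigenvalue (A^T *m A) (s ^+ 2)].

(* For n > 0 the set of singular values is finite and nonempty, so that the
   infimum is a minimum. *)
Definition sigma_min (R : realType) (n : nat) (A : 'M[R]_n) : R :=
  inf (singular_values A).

Definition absv (R : realType) (n : nat) (x : 'cV[R]_n) : 'cV[R]_n :=
  map_mx (fun a => `|a|) x.

Section AbsoluteValueEquation.
Context (R : realType) (n : nat) (A : 'M[R]_n) (b : 'cV[R]_n).

Definition residual (x : 'cV[R]_n) : 'cV[R]_n := A *m x - absv x - b.

Definition ave_g (gamma : R) (x : 'cV[R]_n) : 'cV[R]_n :=
  gamma *: (A^T *m (b + absv x - A *m x)).

Definition ave_rho (rho1 rho2 lam1 lam2 : R) (x : 'cV[R]_n) : R :=
  if residual x == 0 then 0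
  else rho1 / norm2 (residual x) `^ (1 - lam1)
     + rho2 / norm2 (residual x) `^ (1 - lam2).

End AbsoluteValueEquation.

Section AutonomousSystem.
Context (R : realType) (n : nat) (f : 'cV[R]_n.+1 -> 'cV[R]_n.+1).

(* x solves dx/dt = f(x) on [0, +oo[ with x(0) = x0.  Only the values of x on
   [0, +oo[ matter.  At t = 0 continuity is required; if f is continuous,
   the equation then also holds there for the right derivative. *)
Definition is_solution (x0 : 'cV[R]_n.+1) (x : R -> 'cV[R]_n.+1) : Prop :=
  [/\ x 0 = x0,
      {within `[0, +oo[, continuous x} &
      forall t : R, 0 < t -> is_derive t (1 : R) x (f (x t))].

Definition equilibrium (xs : 'cV[R]_n.+1) : Prop := f xs = 0.

Definition lyapunov_stable (xs : 'cV[R]_n.+1) : Prop :=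
  forall eps : R, 0 < eps -> exists2 delta : R, 0 < delta &
    forall x0 x, is_solution x0 x -> norm2 (x0 - xs) < delta ->
      forall t : R, 0 <= t -> norm2 (x t - xs) < eps.

Definition globally_attractive (xs : 'cV[R]_n.+1) : Prop :=
  forall x0 x, is_solution x0 x -> x t @[t --> +oo] --> xs.

(* The notation x(t; x0) presupposes a solution for every x0; without the first
   clause the other ones could hold vacuously. *)
Definition globally_asymptotically_stable (xs : 'cV[R]_n.+1) : Prop :=
  [/\ forall x0, exists x, is_solution x0 x,
      lyapunov_stable xs &
      globally_attractive xs].

Definition settling_time (xs : 'cV[R]_n.+1) (T : 'cV[R]_n.+1 -> R) : Prop :=
  (forall x0, 0 <= T x0) /\
  (forall x0 x, is_solution x0 x -> forall t : R, T x0 <= t -> x t = xs).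

Definition globally_finite_time_stable
    (xs : 'cV[R]_n.+1) (T : 'cV[R]_n.+1 -> R) : Prop :=
  [/\ equilibrium xs, globally_asymptotically_stable xs & settling_time xs T].

Definition globally_fixed_time_stable
    (xs : 'cV[R]_n.+1) (T : 'cV[R]_n.+1 -> R) (Tmax : R) : Prop :=
  [/\ globally_finite_time_stable xs T,
      0 < Tmax &
      forall x0, T x0 <= Tmax].

End AutonomousSystem.

(* Main.v *)
Require Import Defs.
From mathcomp Require Import all_boot all_order all_algebra.
From mathcomp Require Import all_classical all_reals all_analysis.
From mathcomp Require Import ring lra.

Set Implicit Arguments.
Unset Strict Implicit.
Unset Printing Implicit Defensive.

Import Order.TTheory GRing.Theory Num.Theory.
Import numFieldNormedType.Exports.

Local Open Scope classical_set_scope.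
Local Open Scope ring_scope.

(** The squared distance [V = |x - xs|^2 / 2] to the solution [xs] is a strict
    Lyapunov function whose decay forces extinction in a uniformly bounded time.

    Geometry. Write [e = x - xs], [d = |x| - |xs|] (entrywise absolute values)
    and [r = A e - d] for the residual, so that [|d| <= |e|].  Since
    [|A e| >= sigma_min A * |e|], the polarisation identity gives
    [2 <A e, r> >= mu |e|^2 + |r|^2] ([residual_dot]), and
    [mu |e| / L <= |r| <= L |e|] for [L = |A + I| + |A - I|]
    ([residual_ge], [residual_le]).  That [mu > 0] comes from
    [sigma_min A = 1 / |A^-1|], of which [sigma_min_gt1] keeps one half; that
    [sigma_min A] bounds [|A e| / |e|] from below is the variational
    characterisation of singular values ([sigma_min_le]).

    Decay.  The field is [- gamma rho(x) A^T r], so that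
    [V' = - gamma rho(x) <A e, r>] along solutions.  The two powers of
    [|r|] in [rho] have lower bounds in terms of [|e|]: the negative power from
    the upper bound on [|r|], the positive one from the lower bound. This gives
    [V' <= - (c1 V^kappa1 + c2 V^kappa2)] ([ave_field_decay]).

    Settling time.  The superlinear term brings [V] below [1] within time
    [1 / (c2 (kappa2 - 1))] wherever it starts; the sublinear term then
    brings [V] to [0] within [1 / (c1 (1 - kappa1))] ([fixed_time_decay]).

    Existence.  The field is continuous, also at [xs], where it behaves like
    [|r|^lam1] ([ave_field_continuous]), but it is not locally Lipschitz there,
    which rules out a contraction argument.  Peano's theorem applies instead:
    Euler polygons converge pointwise along a free ultrafilter, and continuity
    of the field is enough to pass to the limit in the difference quotients
    ([peano_bounded]).  The field is truncated to make it bounded; as the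
    truncation keeps its direction, [V] still decreases, and solutions stay
    where nothing was cut off ([peano_dissipative]).

    Every solution rests at [xs] from [Tmax] on, which makes the constant
    function [Tmax] a settling time. *)

(** * Euclidean geometry of column vectors *)

Definition dot (R : realType) n (x y : 'cV[R]_n) : R := (x^T *m y) 0 0.

Section Euclidean.
Context {R : realType} {n : nat}.
Implicit Types x y z : 'cV[R]_n.

Lemma dotE x y : dot x y = \sum_i x i 0 * y i 0.
Proof. by rewrite /dot mxE; apply: eq_bigr => i _; rewrite mxE. Qed.

Lemma dotC x y : dot x y = dot y x.
Proof. by rewrite !dotE; apply: eq_bigr => i _; rewrite mulrC. Qed.

Lemma dotDr x y z : dot x (y + z) = dot x y + dot x z.
Proof. by rewrite /dot mulmxDr mxE. Qed.

Lemma dotDl x y z : dot (y + z) x = dot y x + dot z x.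
Proof. by rewrite !(dotC _ x) dotDr. Qed.

Lemma dotZr a x y : dot x (a *: y) = a * dot x y.
Proof. by rewrite /dot -scalemxAr mxE. Qed.

Lemma dotZl a x y : dot (a *: x) y = a * dot x y.
Proof. by rewrite dotC dotZr dotC. Qed.

Lemma dotNr x y : dot x (- y) = - dot x y.
Proof. by rewrite -scaleN1r dotZr mulN1r. Qed.

Lemma dotNl x y : dot (- x) y = - dot x y.
Proof. by rewrite dotC dotNr dotC. Qed.

Definition dotE_lin := (dotDr, dotDl, dotZr, dotZl, dotNr, dotNl).

Lemma norm2_ge0 x : 0 <= norm2 x.
Proof. exact: sqrtr_ge0. Qed.

Lemma norm2_sqr x : norm2 x ^+ 2 = dot x x.
Proof.
rewrite dotE sqr_sqrtr; first by apply: eq_bigr => i _; rewrite expr2.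
by apply: sumr_ge0 => i _; exact: sqr_ge0.
Qed.

Lemma dotxx_ge0 x : 0 <= dot x x.
Proof. by rewrite -norm2_sqr sqr_ge0. Qed.

Lemma dotxx_eq0 x : (dot x x == 0) = (x == 0).
Proof.
rewrite dotE; apply/idP/eqP => [|->]; last first.
  by rewrite big1// => i _; rewrite mxE mul0r.
rewrite psumr_eq0 => [/allP h|i _]; last by rewrite -expr2 sqr_ge0.
apply/colP => i; rewrite mxE; apply/eqP.
by have := h i (mem_index_enum i); rewrite mulf_eq0 orbb.
Qed.

Lemma norm2_eq0 x : (norm2 x == 0) = (x == 0).
Proof. by rewrite -dotxx_eq0 -norm2_sqr sqrf_eq0. Qed.

Lemma norm2_0 : norm2 (0 : 'cV[R]_n) = 0.
Proof. by apply/eqP; rewrite norm2_eq0. Qed.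

Lemma norm2_gt0 x : (0 < norm2 x) = (x != 0).
Proof. by rewrite lt0r norm2_eq0 norm2_ge0 andbT. Qed.

Lemma norm2Z a x : norm2 (a *: x) = `|a| * norm2 x.
Proof.
apply/eqP; rewrite -(@eqrXn2 _ 2)// ?mulr_ge0 ?norm2_ge0//.
by rewrite exprMn !norm2_sqr !dotE_lin real_normK ?num_real// mulrA expr2.
Qed.

Lemma norm2N x : norm2 (- x) = norm2 x.
Proof. by rewrite -scaleN1r norm2Z normrN1 mul1r. Qed.

Lemma norm2_coord x i : `|x i 0| <= norm2 x.
Proof.
rewrite -sqrtr_sqr ler_wsqrtr// (bigD1 i)//= lerDl.
by apply: sumr_ge0 => j _; exact: sqr_ge0.
Qed.

(** Cauchy-Schwarz, from expanding the square of
    [norm2 y *: x - norm2 x *: y]. *)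
Lemma dot_le_norm2 x y : dot x y <= norm2 x * norm2 y.
Proof.
have [->|x0] := eqVneq x 0.
  by rewrite -(scale0r 0) dotZl scale0r norm2_0 !mul0r.
have [->|y0] := eqVneq y 0.
  by rewrite -(scale0r 0) dotZr scale0r norm2_0 mul0r mulr0.
have xy_gt0 : 0 < norm2 x * norm2 y by rewrite mulr_gt0 ?norm2_gt0.
rewrite -subr_ge0 -(pmulr_rge0 _ xy_gt0).
have := dotxx_ge0 (norm2 y *: x - norm2 x *: y).
rewrite !dotE_lin -!norm2_sqr (dotC y x) => h; nra.
Qed.

Lemma norm2D x y : norm2 (x + y) <= norm2 x + norm2 y.
Proof.
rewrite -ler_sqr ?nnegrE ?addr_ge0 ?norm2_ge0// norm2_sqr !dotE_lin.
rewrite -!norm2_sqr (dotC y).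
by have := dot_le_norm2 x y; nra.
Qed.

End Euclidean.

Lemma dot_mulmx (R : realType) m n (A : 'M[R]_(m, n)) x y :
  dot (A *m x) y = dot x (A^T *m y).
Proof. by rewrite /dot trmx_mul mulmxA. Qed.

Section MatrixTopology.
Context {R : realType}.

Lemma mx_entry_le_norm m n (x : 'M[R]_(m, n)) i j : `|x i j| <= `|x|.
Proof.
by rewrite [leRHS]/Num.Def.normr/= mx_normrE; exact: (le_bigmax _ _ (i, j)).
Qed.

Lemma mx_norm_le m n (x : 'M[R]_(m, n)) e :
  0 <= e -> (forall i j, `|x i j| <= e) -> `|x| <= e.
Proof.
move=> e0 xe; rewrite [leLHS]/Num.Def.normr/= mx_normrE.
by apply: bigmax_le => // -[i j] _; exact: xe.
Qed.

Lemma mx_cvgP (T : Type) (F : set_system T) {FF : Filter F} m n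
    (x : T -> 'M[R]_(m, n)) (l : 'M[R]_(m, n)) :
  (forall i j, x t i j @[t --> F] --> l i j) -> x t @[t --> F] --> l.
Proof.
move=> xl; apply/cvgrPdist_le => e e0.
have : \forall t \near F, forall ij : 'I_m * 'I_n,
    `|l ij.1 ij.2 - x t ij.1 ij.2| <= e.
  by apply: filter_forall => -[i j]; move/cvgrPdist_le: (xl i j) => /(_ _ e0).
apply: filterS => t h; apply: mx_norm_le (ltW e0) _ => i j.
by rewrite !mxE; exact: (h (i, j)).
Qed.

Lemma trmx_continuous m n : continuous (fun x : 'M[R]_(m, n) => x^T).
Proof.
move=> x; apply: (@mx_cvgP _ _ (nbhs_filter x)) => i j; rewrite mxE.
under eq_fun do rewrite mxE.
exact: coord_continuous.
Qed.

Lemma mulmx_continuous m n p (A : 'M[R]_(m, n)) :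
  continuous (mulmx A : 'M[R]_(n, p) -> _).
Proof.
move=> x; apply: (@mx_cvgP _ _ (nbhs_filter x)) => i j; rewrite mxE.
under eq_fun do rewrite mxE.
apply: (cvg_big _ (nbhs_filter x)); first exact: add_continuous.
by move=> k _; apply: cvgMr; exact: coord_continuous.
Qed.

Lemma norm2_continuous n : continuous (@norm2 R n).
Proof.
move=> x.
apply: (@continuous_comp _ _ _ (fun x : 'cV[R]_n => \sum_i x i 0 ^+ 2)
  Num.sqrt).
  apply: (cvg_big _ (nbhs_filter x)); first exact: add_continuous.
  move=> i _; rewrite expr2; under eq_fun do rewrite expr2.
  by apply: cvgM; exact: coord_continuous.
exact: sqrt_continuous.
Qed.

(** Heine-Borel is about row vectors, hence the transposition. *)
Lemma norm2_preimage_compact n (a : 'cV[R]_n) (C : set R) r :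
  closed C -> (forall c, C c -> c <= r) ->
  compact [set v : 'rV[R]_n | C (norm2 (v^T - a))].
Proof.
move=> Ccl Cr; apply: bounded_closed_compact.
  exists (r + norm2 a); split; first exact: num_real.
  move=> M rM v /= /Cr vr; apply: mx_norm_le => [|i j].
    rewrite (le_trans _ (ltW rM))// addr_ge0 ?norm2_ge0//.
    by rewrite (le_trans _ vr) ?norm2_ge0.
  rewrite ord1 (le_trans _ (ltW rM))//.
  have := norm2_coord v^T j; rewrite mxE => /le_trans; apply.
  by rewrite -[v^T](subrK a) (le_trans (norm2D _ _))// lerD2r.
apply: (preimage_closed _ Ccl) => v _.
apply: (@continuous_comp _ _ _ (fun v : 'rV[R]_n => v^T - a) (@norm2 R n)).
  apply: (@cvgB _ _ _ _ (nbhs_filter v)); first exact: trmx_continuous.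
  exact: cvg_cst.
exact: norm2_continuous.
Qed.

Lemma norm2_sphere_compact n : compact [set v : 'rV[R]_n | norm2 v^T = 1].
Proof.
rewrite (_ : mkset _ = [set v : 'rV[R]_n | [set c | c = 1] (norm2 (v^T - 0))]).
  apply: (norm2_preimage_compact (r := 1)); first exact: closed_eq.
  by move=> c /= ->.
by apply/funext => v; rewrite /= subr0.
Qed.

End MatrixTopology.

(** * Spectral norm and smallest singular value *)

Section Spectral.
Context {R : realType} {n : nat}.
Implicit Types (A : 'M[R]_n.+1) (x : 'cV[R]_n.+1).

Lemma norm2_sphere_nonempty : exists v : 'cV[R]_n.+1, norm2 v = 1.
Proof.
exists (delta_mx 0 0); apply/eqP; rewrite -(@eqrXn2 _ 2) ?norm2_ge0//.
rewrite norm2_sqr expr1n dotE (bigD1 0)//=.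
rewrite big1 ?mxE ?eqxx ?addr0 ?mulr1// => i i0.
by rewrite !mxE (negbTE i0) mul0r.
Qed.

Lemma norm2_mulmx_continuous A :
  continuous (fun v : 'rV[R]_n.+1 => norm2 (A *m v^T)).
Proof.
move=> v.
apply: (@continuous_comp _ _ _ (fun v : 'rV[R]_n.+1 => A *m v^T) (@norm2 R _)).
  apply: (@continuous_comp _ _ _ (fun v : 'rV[R]_n.+1 => v^T) (mulmx A)).
    exact: trmx_continuous.
  exact: mulmx_continuous.
exact: norm2_continuous.
Qed.

Lemma norm2_sphere_row_nonempty : [set v : 'rV[R]_n.+1 | norm2 v^T = 1] !=set0.
Proof.
by have [v v1] := norm2_sphere_nonempty; exists v^T; rewrite /= trmxK.
Qed.

Lemma norm2_normalized x : x != 0 -> norm2 ((norm2 x)^-1 *: x) = 1.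
Proof.
move=> x0; rewrite norm2Z ger0_norm ?invr_ge0 ?norm2_ge0// mulVf//.
by rewrite norm2_eq0.
Qed.

Lemma spectral_norm_has_ubound A :
  has_ubound [set norm2 (A *m x) | x in [set x : 'cV[R]_n.+1 | norm2 x = 1]].
Proof.
have [c _ cmax] := EVT_max_rV norm2_sphere_row_nonempty
  (@norm2_sphere_compact R _)
  (continuous_subspaceT (@norm2_mulmx_continuous A)).
exists (norm2 (A *m c^T)) => _ [x /= x1 <-].
by rewrite -(trmxK x); apply: cmax; rewrite inE/= trmxK.
Qed.

Lemma spectral_normP A x : norm2 (A *m x) <= spectral_norm A * norm2 x.
Proof.
have [->|x0] := eqVneq x 0; first by rewrite mulmx0 norm2_0 mulr0.
rewrite -ler_pdivrMr ?norm2_gt0// mulrC.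
rewrite -[X in X * _](ger0_norm (x := _^-1)) ?invr_ge0 ?norm2_ge0//.
rewrite -norm2Z scalemxAr; apply: ub_le_sup.
  exact: spectral_norm_has_ubound.
by exists ((norm2 x)^-1 *: x) => //=; exact: norm2_normalized.
Qed.

(** The minimum of [norm2 (A *m x)] over the sphere is a singular value: at a
   minimiser [c] the quadratic form of [A^T *m A - m^2] is nonnegative and
   vanishes, so that its first variation, in the direction
   [w := (A^T *m A - m^2) *m c], vanishes as well. *)
Lemma sphere_min_singular A (c : 'cV[R]_n.+1) :
  norm2 c = 1 -> (forall x, norm2 (A *m c) * norm2 x <= norm2 (A *m x)) ->
  singular_values A (norm2 (A *m c)).
Proof.
set m := norm2 (A *m c) => c1 cmin.
have c0 : c != 0 by rewrite -norm2_eq0 c1 oner_eq0.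
split; first exact: norm2_ge0.
pose q x := dot (A *m x) (A *m x) - m ^+ 2 * dot x x.
have q_ge0 x : 0 <= q x.
  by rewrite subr_ge0 -!norm2_sqr -exprMn ler_sqr ?nnegrE ?mulr_ge0 ?norm2_ge0.
set w := A^T *m A *m c - m ^+ 2 *: c.
have dotw z : dot z w = dot (A *m z) (A *m c) - m ^+ 2 * dot z c.
  by rewrite /w !dotE_lin -mulmxA -dot_mulmx.
have wE : w = A^T *m A *m c - m ^+ 2 *: c by [].
clearbody w; have qcw t : q (c + t *: w) = 2 * t * dot w w + t ^+ 2 * q w.
  have cc : dot c c = 1 by rewrite -norm2_sqr c1 expr1n.
  have AcAc : dot (A *m c) (A *m c) = m ^+ 2 by rewrite -norm2_sqr.
  rewrite dotw /q mulmxDr -scalemxAr !dotE_lin AcAc cc (dotC c w).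
  by rewrite (dotC (A *m c)); ring.
(* The minimum over [t] of [2 t |w|^2 + t^2 q w] is negative unless [w = 0];
   the denominator [q w + 1] avoids dividing by zero. *)
have w0 : w = 0.
  apply/eqP; rewrite -dotxx_eq0; apply: contraT => p0.
  have p_gt0 : 0 < dot w w by rewrite lt0r p0 dotxx_ge0.
  have := q_ge0 (c + (- (dot w w / (q w + 1))) *: w).
  rewrite qcw leNgt => /negP[].
  have q1 : 0 < q w + 1 by rewrite ltr_wpDl.
  set s := dot w w / _; have s0 : 0 < s by rewrite divr_gt0.
  have -> : dot w w = s * (q w + 1) by rewrite divfK ?gt_eqF.
  have := q_ge0 w; nra.
apply/eigenvalueP; exists c^T; last first.
  by rewrite -(trmx0 _ n.+1 1) (inj_eq trmx_inj).
have /eqP := w0; rewrite wE subr_eq0 => /eqP/(congr1 trmx).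
by rewrite !trmx_mul trmxK linearZ.
Qed.

Lemma singular_value_vector A s : singular_values A s ->
  exists2 x, x != 0 & norm2 (A *m x) = s * norm2 x.
Proof.
move=> [s0 /eigenvalueP[v vs v0]]; exists v^T.
  by rewrite -(trmx0 _ 1 n.+1) (inj_eq trmx_inj).
apply/eqP; rewrite -(@eqrXn2 _ 2)// ?mulr_ge0 ?norm2_ge0// exprMn !norm2_sqr.
have /(congr1 trmx) := vs; rewrite !trmx_mul trmxK linearZ/= => vs'.
by rewrite dot_mulmx mulmxA vs' dotZr.
Qed.

Lemma min_singular_value A :
  exists2 s, singular_values A s & forall x, s * norm2 x <= norm2 (A *m x).
Proof.
have [c] := EVT_min_rV norm2_sphere_row_nonempty
  (@norm2_sphere_compact R _)
  (continuous_subspaceT (@norm2_mulmx_continuous A)).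
rewrite inE /= => c1 cmin0.
have cmin y : norm2 (A *m c^T) * norm2 y <= norm2 (A *m y).
  have [->|y0] := eqVneq y 0; first by rewrite mulmx0 norm2_0 mulr0.
  rewrite -ler_pdivlMr ?norm2_gt0// mulrC.
  rewrite -[X in X * _](ger0_norm (x := _^-1)) ?invr_ge0 ?norm2_ge0//.
  rewrite -norm2Z scalemxAr; have := cmin0 ((norm2 y)^-1 *: y)^T.
  rewrite inE/= trmxK; apply.
  exact: norm2_normalized.
by exists (norm2 (A *m c^T)) => //; exact: sphere_min_singular.
Qed.

Lemma sigma_min_le A x : sigma_min A * norm2 x <= norm2 (A *m x).
Proof.
have [s sA smin] := min_singular_value A; apply: le_trans (smin x).
by rewrite ler_wpM2r ?norm2_ge0//; apply: ge_inf => //; exists 0 => t [].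
Qed.

(** A singular vector [x] for [s] satisfies
    [|x| = |A^-1 A x| <= |A^-1| s |x|], so that [s >= 1 / |A^-1| > 1]. *)
Lemma sigma_min_gt1 A : A \in unitmx -> spectral_norm (invmx A) < 1 ->
  1 < sigma_min A.
Proof.
move=> uA; set K := spectral_norm _ => K1.
have svK s : singular_values A s -> 1 <= K * s.
  move=> /singular_value_vector[x x0 Ax].
  have := spectral_normP (invmx A) (A *m x).
  by rewrite mulKmx// Ax mulrA -[leLHS]mul1r ler_pM2r ?norm2_gt0.
have [s0 s0A _] := min_singular_value A.
have K0 : 0 < K.
  have s0_ge0 : 0 <= s0 by case: s0A.
  by have := svK _ s0A; nra.
apply: (@lt_le_trans _ _ K^-1); first by rewrite invf_gt1.
apply: lb_le_inf; first by exists s0.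
by move=> s /svK; rewrite -ler_pdivrMl// mulr1.
Qed.

End Spectral.

(** * The residual of the absolute value equation *)

Section Residual.
Context {R : realType} {n : nat} (A : 'M[R]_n.+1) (b xs : 'cV[R]_n.+1).
Hypothesis sigma_gt1 : 1 < sigma_min A.
Hypothesis residual_xs : residual A b xs = 0.
Let L := spectral_norm (A + 1%:M) + spectral_norm (A - 1%:M).
Let mu := sigma_min A ^+ 2 - 1.
Implicit Types x y : 'cV[R]_n.+1.

Lemma norm2_absv_dist x y : norm2 (absv x - absv y) <= norm2 (x - y).
Proof.
rewrite ler_wsqrtr//; apply: ler_sum => i _.
rewrite !mxE -[leLHS]real_normK ?num_real// -[leRHS]real_normK ?num_real//.
by rewrite ler_sqr ?nnegrE// ler_dist_dist.
Qed.

Lemma sigma_min_sqrB1_gt0 : 0 < mu.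
Proof. by rewrite subr_gt0 exprn_egt1. Qed.

(** [2 v] is the difference, and [2 A v] the sum, of [(A + I) v] and
    [(A - I) v]; [L] therefore dominates both [2] and [2 |A|]. *)
Lemma spectral_norm_sum_ge2 : 2 <= L.
Proof.
have [v v1] := @norm2_sphere_nonempty R n.
have v2 : 2 *: v = (A + 1%:M) *m v - (A - 1%:M) *m v.
  by rewrite -mulmxBl opprB addrC addrA subrK mulmxDl mul1mx scaler_nat mulr2n.
have := norm2D ((A + 1%:M) *m v) (- ((A - 1%:M) *m v)).
rewrite -v2 norm2Z norm2N v1 normr_nat mulr1 => /le_trans; apply.
by apply: lerD; rewrite -[leRHS]mulr1 -v1 spectral_normP.
Qed.

Lemma norm2_mulmx_le_sum x : 2 * norm2 (A *m x) <= L * norm2 x.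
Proof.
have := norm2D ((A + 1%:M) *m x) ((A - 1%:M) *m x).
rewrite -mulmxDl addrACA subrr addr0 -mulr2n -[A *+ 2]scaler_nat -scalemxAl.
rewrite norm2Z normr_nat => /le_trans; apply.
by rewrite mulrDl lerD// spectral_normP.
Qed.

(** The decay rates that follow from [residual_le], [residual_ge] and
    [residual_dot] are the constants [c1] and [c2] of the theorem times
    [L^2 / mu], which is at least [1] by this bound. *)
Lemma sigma_min_sqrB1_le : mu <= L ^+ 2.
Proof.
have [v v1] := @norm2_sphere_nonempty R n.
have := sigma_min_le A v; have := norm2_mulmx_le_sum v.
have := spectral_norm_sum_ge2; rewrite v1 !mulr1 => L2 AL sA.
have sL : sigma_min A ^+ 2 <= L ^+ 2.
  by have s1 := sigma_gt1; rewrite ler_sqr ?nnegrE; lra.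
by rewrite /mu lerBlDr (le_trans sL)// lerDl.
Qed.

Lemma residualE x : residual A b x = A *m (x - xs) - (absv x - absv xs).
Proof.
rewrite -[LHS]subr0 -residual_xs /residual mulmxBr.
by apply/colP => i; rewrite !mxE; ring.
Qed.

Lemma residual_le x : norm2 (residual A b x) <= L * norm2 (x - xs).
Proof.
rewrite residualE (le_trans (norm2D _ _))// norm2N.
have := norm2_absv_dist x xs; have := norm2_mulmx_le_sum (x - xs).
have := spectral_norm_sum_ge2; have := norm2_ge0 (x - xs); nra.
Qed.

(** With [e := x - xs] and [d := absv x - absv xs], the residual is
    [A *m e - d], and the bound is the polarisation identity
    [2 <A e, A e - d> = |A e|^2 + |A e - d|^2 - |d|^2] together with
    [|A e| >= sigma_min A * |e|] and [|d| <= |e|]. *)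
Lemma residual_dot x :
  mu * norm2 (x - xs) ^+ 2 + norm2 (residual A b x) ^+ 2
    <= 2 * dot (A *m (x - xs)) (residual A b x).
Proof.
have := norm2_absv_dist x xs; have := sigma_min_le A (x - xs).
have := norm2_ge0 (absv x - absv xs); have := norm2_ge0 (x - xs).
rewrite residualE; move: (x - xs) (absv x - absv xs) => e d e0 d0 Ae de.
rewrite !norm2_sqr !dotE_lin -!norm2_sqr (dotC d) /mu.
suff : sigma_min A ^+ 2 * norm2 e ^+ 2 <= norm2 (A *m e) ^+ 2
       /\ norm2 d ^+ 2 <= norm2 e ^+ 2 by move=> [h1 h2]; nra.
split; [rewrite -exprMn|]; rewrite ler_sqr ?nnegrE ?norm2_ge0//.
by rewrite mulr_ge0// ltW// (lt_trans ltr01).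
Qed.

(** Cauchy-Schwarz applied to [residual_dot], with [|A e| <= L |e| / 2]. *)
Lemma residual_ge x : mu * norm2 (x - xs) <= L * norm2 (residual A b x).
Proof.
have [e0|] := eqVneq (x - xs) 0.
  rewrite e0 norm2_0 mulr0 mulr_ge0 ?norm2_ge0//.
  by rewrite (le_trans _ spectral_norm_sum_ge2).
rewrite -norm2_gt0 => e0; rewrite -(ler_pM2r e0).
have := dot_le_norm2 (A *m (x - xs)) (residual A b x).
have := residual_dot x; have := norm2_mulmx_le_sum (x - xs).
have := norm2_ge0 (residual A b x); have := norm2_ge0 (A *m (x - xs)).
move: (norm2 (A *m _)) (dot _ _) (norm2 (residual _ _ _)).
by move=> a p r a0 r0 h1 h2 h3; nra.
Qed.

Lemma residual_eq0 x : (residual A b x == 0) = (x == xs).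
Proof.
apply/idP/eqP => [/eqP r0|->]; last by rewrite residual_xs.
have := residual_ge x.
rewrite r0 norm2_0 mulr0 pmulr_rle0 ?sigma_min_sqrB1_gt0// => h.
apply/eqP; rewrite -subr_eq0 -norm2_eq0; apply/eqP/le_anti.
by rewrite h norm2_ge0.
Qed.

End Residual.

(** * Decay of the squared distance *)

Section DecayRates.
Context {R : realType}.
Implicit Types (E r L mu gamma rho lam : R).

(** The powers of [2] in the constants of the theorem come from the factor [1/2]
    in [V = E^2 / 2]. *)
Lemma powR_half_sqr E k : 0 <= E ->
  2 `^ ((k - 1) / 2) * (2^-1 * E ^+ 2) `^ ((k + 1) / 2) = E `^ (k + 1) / 2.
Proof.
move=> E0; have -> : (k - 1) / 2 = (k + 1) / 2 - 1 by field.
have -> : k + 1 = 2%:R * ((k + 1) / 2) by field.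
rewrite [2%:R * _ / _]mulrAC mulfV// mul1r; move: ((k + 1) / 2) => h.
rewrite powRM ?invr_ge0 ?sqr_ge0// powRrM powR_mulrn// mulrA mulrC.
congr (_ * _).
rewrite powRD ?pnatr_eq0 ?implybT// powR_inv1// mulrAC -powRM ?invr_ge0//.
by rewrite mulfV// powR1 mul1r.
Qed.

(** Here [E] stands for [|x - xs|] and [r] for the norm of the residual.  As
    [r^(1 - lam)] is in the denominator with [1 - lam >= 0], the upper bound on
    [r] is what is needed; the slack is the factor [mu / L^2 <= 1]. *)
Lemma decay_rate1 E r L mu gamma rho lam :
  0 < E -> 0 < r -> 0 < L -> 0 < mu -> 0 < gamma -> 0 < rho ->
  mu <= L ^+ 2 -> r <= L * E -> lam <= 1 ->
  2 `^ ((lam - 1) / 2) * gamma * rho * mu ^+ 2 / L `^ (3 - lam)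
    * (2^-1 * E ^+ 2) `^ ((lam + 1) / 2)
  <= gamma * (rho / r `^ (1 - lam)) * (mu * E ^+ 2 / 2).
Proof.
move=> E0 r0 L0 mu0 g0 rho0 muL rLE lam1.
rewrite -!(mulrA (2 `^ _)) mulrCA (powR_half_sqr _ (ltW E0)).
have -> : L `^ (3 - lam) = L ^+ 2 * L `^ (1 - lam).
  rewrite -powR_mulrn ?ltW// -powRD ?(gt_eqF L0) ?implybT//.
  by congr (_ `^ _); ring.
have -> : E `^ (lam + 1) = E ^+ 2 / E `^ (1 - lam).
  rewrite -powR_mulrn ?ltW// -powRB ?(gt_eqF E0) ?implybT//.
  by congr (_ `^ _); ring.
have LEr : (L `^ (1 - lam) * E `^ (1 - lam))^-1 <= (r `^ (1 - lam))^-1.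
  rewrite -(powRM _ (ltW L0) (ltW E0)) lef_pV2 ?posrE ?powR_gt0 ?mulr_gt0//.
  by apply: ge0_ler_powR => //; rewrite ?subr_ge0// nnegrE ?mulr_ge0 ?ltW.
have muL1 : mu / L ^+ 2 <= 1 by rewrite ler_pdivrMr ?exprn_gt0// mul1r.
move: (powR_gt0 (1 - lam) L0) (powR_gt0 (1 - lam) E0).
move: (powR_gt0 (1 - lam) r0) LEr.
move: (L `^ _) (E `^ _) (r `^ _) => P Q S S0 LEr P0 Q0.
have E2 : 0 < E ^+ 2 by rewrite exprn_gt0.
have L2 : 0 < L ^+ 2 by rewrite exprn_gt0.
rewrite [leLHS](_ : _ = gamma * rho * mu * E ^+ 2 / 2
                        * ((mu / L ^+ 2) * (P * Q)^-1)); last first.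
  by field; rewrite !gt_eqF.
rewrite [leRHS](_ : _ = gamma * rho * mu * E ^+ 2 / 2 * (1 * S^-1)); last first.
  by field; rewrite !gt_eqF.
apply: ler_wpM2l; first by rewrite !mulr_ge0 ?ltW.
by apply: ler_pM => //; rewrite ?divr_ge0 ?invr_ge0 ?mulr_ge0 ?ltW.
Qed.

(** The counterpart for [1 - lam <= 0], where the lower bound on [r] serves. *)
Lemma decay_rate2 E r L mu gamma rho lam :
  0 < E -> 0 < r -> 0 < L -> 0 < mu -> 0 < gamma -> 0 < rho ->
  mu <= L ^+ 2 -> mu * E <= L * r -> 1 <= lam ->
  2 `^ ((lam - 1) / 2) * gamma * rho * mu `^ (1 + lam) / L `^ (1 + lam)
    * (2^-1 * E ^+ 2) `^ ((lam + 1) / 2)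
  <= gamma * (rho / r `^ (1 - lam)) * (mu * E ^+ 2 / 2).
Proof.
move=> E0 r0 L0 mu0 g0 rho0 muL muELr lam1.
rewrite -!(mulrA (2 `^ _)) mulrCA (powR_half_sqr _ (ltW E0)).
have split2 a : 0 < a -> a `^ (1 + lam) = a ^+ 2 * a `^ (lam - 1).
  move=> a0; rewrite -powR_mulrn ?ltW// -powRD ?(gt_eqF a0) ?implybT//.
  by congr (_ `^ _); ring.
rewrite [lam + 1]addrC !split2//.
have -> : 1 - lam = - (lam - 1) by rewrite opprB.
rewrite powRN invrK.
have LEr : mu `^ (lam - 1) * E `^ (lam - 1) / L `^ (lam - 1) <= r `^ (lam - 1).
  rewrite ler_pdivrMr ?powR_gt0// -(powRM _ (ltW mu0) (ltW E0)).
  rewrite -(powRM _ (ltW r0) (ltW L0)) [r * L]mulrC.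
  by apply: ge0_ler_powR => //; rewrite ?subr_ge0// nnegrE ?mulr_ge0 ?ltW.
have muL1 : mu / L ^+ 2 <= 1 by rewrite ler_pdivrMr ?exprn_gt0// mul1r.
move: (powR_gt0 (lam - 1) L0) (powR_gt0 (lam - 1) E0) (powR_gt0 (lam - 1) r0).
move: (powR_gt0 (lam - 1) mu0) LEr.
move: (mu `^ _) (L `^ _) (E `^ _) (r `^ _) => M P Q S LEr M0 P0 Q0 S0.
have E2 : 0 < E ^+ 2 by rewrite exprn_gt0.
have L2 : 0 < L ^+ 2 by rewrite exprn_gt0.
rewrite [leLHS](_ : _ = gamma * rho * mu * E ^+ 2 / 2
                        * ((mu / L ^+ 2) * (M * Q / P))); last first.
  by field; rewrite !gt_eqF.
rewrite [leRHS](_ : _ = gamma * rho * mu * E ^+ 2 / 2 * (1 * S)); last first.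
  by field.
apply: ler_wpM2l; first by rewrite !mulr_ge0 ?ltW.
by apply: ler_pM => //; rewrite ?divr_ge0 ?invr_ge0 ?mulr_ge0 ?ltW.
Qed.

End DecayRates.

Section Decay.
Context {R : realType} {n : nat} (A : 'M[R]_n.+1) (b xs : 'cV[R]_n.+1).
Context (rho1 rho2 gamma lam1 lam2 : R).
Hypothesis sigma_gt1 : 1 < sigma_min A.
Hypothesis residual_xs : residual A b xs = 0.
Hypotheses (rho1_gt0 : 0 < rho1) (rho2_gt0 : 0 < rho2) (gamma_gt0 : 0 < gamma).
Hypotheses (lam1_gt0 : 0 < lam1) (lam1_lt1 : lam1 < 1) (lam2_gt1 : 1 < lam2).
Let L := spectral_norm (A + 1%:M) + spectral_norm (A - 1%:M).
Let mu := sigma_min A ^+ 2 - 1.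
Let f x := ave_rho A b rho1 rho2 lam1 lam2 x *: ave_g A b gamma x.
Let c1 := 2 `^ ((lam1 - 1) / 2) * gamma * rho1 * mu ^+ 2 / L `^ (3 - lam1).
Let c2 := 2 `^ ((lam2 - 1) / 2) * gamma * rho2 * mu `^ (1 + lam2)
          / L `^ (1 + lam2).
Implicit Types x : 'cV[R]_n.+1.

Lemma ave_g_residual x : ave_g A b gamma x = - gamma *: (A^T *m residual A b x).
Proof.
have -> : ave_g A b gamma x = gamma *: (A^T *m (- residual A b x)).
  by congr (_ *: (_ *m _)); apply/colP => i; rewrite !mxE; ring.
by rewrite mulmxN scalerN scaleNr.
Qed.

Lemma ave_field_dot x : dot (x - xs) (f x) =
  - (gamma * ave_rho A b rho1 rho2 lam1 lam2 x
     * dot (A *m (x - xs)) (residual A b x)).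
Proof. by rewrite /f ave_g_residual !dotZr -dot_mulmx; ring. Qed.

Lemma ave_field_decay x :
  dot (x - xs) (f x)
    <= - (c1 * (2^-1 * norm2 (x - xs) ^+ 2) `^ ((lam1 + 1) / 2)
          + c2 * (2^-1 * norm2 (x - xs) ^+ 2) `^ ((lam2 + 1) / 2)).
Proof.
have := lam1_gt0; have := lam1_lt1; have := lam2_gt1 => l2 l1' l1.
have mu0 := sigma_min_sqrB1_gt0 sigma_gt1; rewrite -/mu in mu0.
have L2 := spectral_norm_sum_ge2 A; rewrite -/L in L2.
have L0 : 0 < L by lra.
rewrite ave_field_dot lerN2.
have [xxs|xxs] := eqVneq x xs.
  rewrite xxs subrr norm2_0 expr0n/= mulr0.
  rewrite !powR0; [|by rewrite gt_eqF//; lra..].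
  by rewrite mulmx0 /dot trmx0 mul0mx mxE !mulr0 addr0.
have E0 : 0 < norm2 (x - xs) by rewrite norm2_gt0 subr_eq0.
have r0 : 0 < norm2 (residual A b x).
  by rewrite norm2_gt0 (residual_eq0 sigma_gt1 residual_xs).
have ru := residual_le residual_xs x.
have rl := residual_ge sigma_gt1 residual_xs x.
have rd := residual_dot sigma_gt1 residual_xs x.
have muL := sigma_min_sqrB1_le sigma_gt1.
rewrite -/L -/mu in ru rl rd muL.
rewrite /ave_rho (residual_eq0 sigma_gt1 residual_xs) (negbTE xxs).
move: (norm2 (x - xs)) (norm2 (residual A b x)) (dot _ _) E0 r0 ru rl rd.
move=> E r p E0 r0 ru rl rd.
have pE : mu * E ^+ 2 / 2 <= p by nra.
apply: (@le_trans _ _ (gamma * (rho1 / r `^ (1 - lam1) + rho2 / r `^ (1 - lam2))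
                       * (mu * E ^+ 2 / 2))); last first.
  apply: ler_wpM2l => //; rewrite pmulr_rge0//.
  by rewrite addr_ge0// divr_ge0 ?powR_ge0 ?(ltW rho1_gt0) ?(ltW rho2_gt0).
rewrite mulrDr mulrDl lerD//.
  by apply: decay_rate1 => //; exact: ltW.
by apply: decay_rate2 => //; exact: ltW.
Qed.

End Decay.

(** * Differential inequalities *)

Section FixedTime.
Context {R : realType}.
Implicit Types (F V : R -> R).

Lemma mean_value_ge F (dF : R -> R) a b m :
  a <= b -> {within `[a, b], continuous F} ->
  (forall t, a < t < b -> is_derive t (1 : R) F (dF t) /\ m <= dF t) ->
  m * (b - a) <= F b - F a.
Proof.
rewrite le_eqVlt => /predU1P[->|ab] cF dFm; first by rewrite !subrr mulr0.
have dF' x : x \in `]a, b[%R -> is_derive x 1 F (dF x).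
  by rewrite in_itv => /dFm[].
have [c + ->] := MVT ab dF' cF.
by rewrite in_itv => /dFm[_ mc]; rewrite ler_wpM2r// subr_ge0 ltW.
Qed.

Lemma powR_continuous (k x : R) :
  0 < x -> {for x, continuous (fun y => y `^ k)}.
Proof.
move=> x0; apply: differentiable_continuous; apply/derivable1_diffP.
by have [] := is_derive1_powR k x0.
Qed.

Lemma within_powR V (k : R) a b :
  {within `[a, b], continuous V} -> (forall t, a <= t <= b -> 0 < V t) ->
  {within `[a, b], continuous (fun t => V t `^ k)}.
Proof.
move=> /subspace_continuousP cV V0; apply/subspace_continuousP => t tab.
have Vt : 0 < V t by apply: V0; move: tab; rewrite /= in_itv.
apply: (@cvg_comp _ _ _ V (fun y => y `^ k) _ (nbhs (V t))).
  exact: cV.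
exact: powR_continuous.
Qed.

(** Along [V' <= - c V^k] with [V > 0], the chain rule bounds the derivative
    of [V^(1-k) / (k-1)], which is [- V^(-k) V'], from below by [c].  The
    division by [k-1] makes one statement of the two cases [k < 1] and
    [k > 1]. *)
Lemma powR_decay V (dV : R -> R) c k a b :
  k != 1 -> a <= b ->
  {within `[a, b], continuous V} -> (forall t, a <= t <= b -> 0 < V t) ->
  (forall t, a < t < b ->
     is_derive t (1 : R) V (dV t) /\ dV t <= - (c * V t `^ k)) ->
  c * (b - a) <= (k - 1)^-1 * V b `^ (1 - k) - (k - 1)^-1 * V a `^ (1 - k).
Proof.
move=> k1 ab cV V0 dVc.
apply: (@mean_value_ge (fun t => (k - 1)^-1 * V t `^ (1 - k))
          (fun t => - (V t `^ (- k) * dV t))) => // [|t tab].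
  by move=> t; apply: cvgMr; exact: within_powR.
have /andP[at_ tb] := tab; have [dVt dVle] := dVc t tab.
have Vt : 0 < V t by rewrite V0// !ltW.
split.
  have dP := is_derive1_comp (is_derive1_powR (1 - k) Vt) dVt.
  have -> : - (V t `^ (- k) * dV t)
          = (k - 1)^-1 *: ((1 - k) * V t `^ (1 - k - 1) * dV t).
    rewrite /GRing.scale/= (_ : 1 - k - 1 = - k); last by ring.
    by field; rewrite subr_eq0.
  exact: is_deriveZ.
have : V t `^ (- k) * (c * V t `^ k) <= V t `^ (- k) * (- dV t).
  by rewrite ler_wpM2l ?powR_ge0// lerNr.
by rewrite mulrCA powRN mulVf ?gt_eqF ?powR_gt0// mulr1 mulrN.
Qed.

Lemma one_powR (k : R) : 1 `^ k = 1 :> R.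
Proof. by rewrite powR1. Qed.

Lemma powR_le1 (x k : R) : 0 <= x -> x <= 1 -> 0 <= k -> x `^ k <= 1.
Proof.
by move=> x0 x1 k0; rewrite -[leRHS](one_powR k) ge0_ler_powR ?nnegrE.
Qed.

Lemma within_segment (V : R -> R) (a b : R) : 0 <= a ->
  {within `[0, +oo[, continuous V} -> {within `[a, b], continuous V}.
Proof.
by move=> a0; apply: continuous_subspaceW; apply: subset_itv; rewrite bnd_simp.
Qed.

Lemma derive_le0_decr V (dV : R -> R) :
  {within `[0, +oo[, continuous V} ->
  (forall t : R, 0 < t -> is_derive t (1 : R) V (dV t) /\ dV t <= 0) ->
  forall s t, 0 <= s <= t -> V t <= V s.
Proof.
move=> cV dVle s t /andP[s0 st].
rewrite -subr_ge0 -[leLHS](mul0r (t - s)) -[V s - V t]addrC -[V s]opprK.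
apply: (@mean_value_ge (fun t => - V t) (fun t => - dV t) s t 0 st).
  by move=> u; apply: cvgN; exact: within_segment.
move=> u /andP[su _]; have [dVu dVu_le] := dVle u (le_lt_trans s0 su).
by split; [exact: is_deriveN|rewrite oppr_ge0].
Qed.

(** If [V] were positive at some time after the bound, it would be positive
    before, being nonincreasing, so that [powR_decay] applies in both phases. *)
Lemma fixed_time_decay V (dV : R -> R) (c1 c2 k1 k2 : R) :
  0 < c1 -> 0 < c2 -> k1 < 1 -> 1 < k2 ->
  (forall t : R, 0 <= t -> 0 <= V t) ->
  {within `[0, +oo[, continuous V} ->
  (forall t : R, 0 < t -> is_derive t (1 : R) V (dV t)
     /\ dV t <= - (c1 * V t `^ k1 + c2 * V t `^ k2)) ->
  forall t, 1 / (c1 * (1 - k1)) + 1 / (c2 * (k2 - 1)) <= t -> V t = 0.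
Proof.
move=> c1_gt0 c2_gt0 k1_lt1 k2_gt1 V0 cV dVle t Tt.
have subW a b : 0 <= a -> {within `[a, b], continuous V}.
  by move=> a0; exact: within_segment.
have Vdecr : forall s t, 0 <= s <= t -> V t <= V s.
  apply: (derive_le0_decr (dV := dV)) => // s s0.
  have [dVs dVs_le] := dVle s s0.
  split=> //; rewrite (le_trans dVs_le)// oppr_le0.
  by rewrite addr_ge0// mulr_ge0 ?powR_ge0 ?(ltW c1_gt0) ?(ltW c2_gt0).
apply/eqP; apply: contraT => Vt_neq0.
have k1' : 0 < 1 - k1 by rewrite subr_gt0.
have k2' : 0 < k2 - 1 by rewrite subr_gt0.
set T1 := 1 / (c1 * (1 - k1)) in Tt; set T2 := 1 / (c2 * (k2 - 1)) in Tt.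
have T1_ge0 : 0 <= T1 by rewrite divr_ge0 ?mulr_ge0 ?ltW.
have T2_ge0 : 0 <= T2 by rewrite divr_ge0 ?mulr_ge0 ?ltW.
have Vpos s : 0 <= s <= t -> 0 < V s.
  move=> st; apply: lt_le_trans (Vdecr s t st).
  by rewrite lt0r Vt_neq0 V0// (le_trans _ Tt)// addr_ge0.
have T2t : T2 <= t by rewrite (le_trans _ Tt)// lerDr.
(* Until [T2] the superlinear term alone brings [V] below [1]. *)
have VT2 : V T2 <= 1.
  have Vpos2 s : 0 <= s <= T2 -> 0 < V s.
    by move=> /andP[s0 sT2]; rewrite Vpos// s0 (le_trans sT2).
  have dV2 s : 0 < s < T2 ->
      is_derive s (1 : R) V (dV s) /\ dV s <= - (c2 * V s `^ k2).
    move=> /andP[s0 _]; have [dVs dVs_le] := dVle s s0; split=> //.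
    by rewrite (le_trans dVs_le)// lerN2 lerDr mulr_ge0 ?powR_ge0// ltW.
  have := powR_decay (negbT (gt_eqF k2_gt1)) T2_ge0 (subW _ _ (lexx 0))
    Vpos2 dV2.
  rewrite subr0 -mulrBr -ler_pdivrMl ?invr_gt0// invrK.
  have -> : (k2 - 1) * (c2 * T2) = 1 by rewrite /T2; field; rewrite !gt_eqF.
  have := Vpos 0; rewrite lexx (le_trans T2_ge0)// => /(_ isT) V00.
  have := powR_gt0 (1 - k2) V00 => G0 G1.
  rewrite leNgt; apply/negP => V1.
  have : V T2 `^ (1 - k2) <= 1.
    rewrite -opprB powRN invf_le1 ?powR_gt0 ?(lt_trans ltr01)//.
    rewrite -[leLHS](one_powR (k2 - 1)).
    apply: ge0_ler_powR; rewrite ?nnegrE ?(ltW V1) ?(ltW k2')//.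
    exact: le_trans ler01 (ltW V1).
  by lra.
(* From [T2] on the sublinear term alone exhausts [V <= 1] within [T1]. *)
have T12 : T2 <= T1 + T2 by rewrite lerDr.
have Vpos1 s : T2 <= s <= T1 + T2 -> 0 < V s.
  by move=> /andP[s0 sT]; rewrite Vpos// (le_trans T2_ge0 s0) (le_trans sT).
have dV1 s : T2 < s < T1 + T2 ->
    is_derive s (1 : R) V (dV s) /\ dV s <= - (c1 * V s `^ k1).
  move=> /andP[s0 _]; have [dVs dVs_le] := dVle s (le_lt_trans T2_ge0 s0).
  split=> //; rewrite (le_trans dVs_le)// lerN2 lerDl.
  by rewrite mulr_ge0 ?powR_ge0// ltW.
have := powR_decay (negbT (lt_eqF k1_lt1)) T12 (subW _ _ T2_ge0) Vpos1 dV1.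
have := powR_le1 (V0 _ T2_ge0) VT2 (ltW k1').
have : 0 < V (T1 + T2) `^ (1 - k1) by rewrite powR_gt0// Vpos// Tt addr_ge0.
rewrite addrK -mulrBr => G0 G1.
have -> : c1 * T1 = (1 - k1)^-1 by rewrite /T1; field; rewrite !gt_eqF.
have -> : (k1 - 1)^-1 = - (1 - k1)^-1 by rewrite -invrN opprB.
have : 0 < (1 - k1)^-1 by rewrite invr_gt0.
by nra.
Qed.

End FixedTime.

(** * Existence of solutions *)

Lemma ultra_fmap (T T' : Type) (g : T -> T') (U : set_system T) :
  UltraFilter U -> UltraFilter (g @ U).
Proof.
move=> UU; have PU : ProperFilter U by exact: ultra_proper.
apply: Build_UltraFilter => G PG sUG.
apply/seteqP; split=> // B GB.
have [//|UB] := in_ultra_setVsetC (g @^-1` B) UU.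
have GCB : G (~` B) by exact: sUG.
have : G (B `&` ~` B) by exact: filterI.
by rewrite setICr => /filter_not_empty.
Qed.

Section Euler.
Context {R : realType} {V : normedModType R} (f : V -> V) (x0 : V).

Definition euler (h : R) (j : nat) : V := iter j (fun y => y + h *: f y) x0.

(** The increments of the polygon are [h] times a sum of values of [f], hence
    close to multiples of [v] wherever [f] is close to [v]. *)
Lemma euler_increment h v eps i m : 0 <= h ->
  (forall j, (i <= j < i + m)%N -> `|f (euler h j) - v| <= eps) ->
  `|euler h (i + m) - euler h i - (m%:R * h) *: v| <= m%:R * h * eps.
Proof.
move=> h0; elim: m => [|m IHm] fv.
  by rewrite addn0 subrr !mul0r scale0r subrr normr0.
rewrite addnS /= -/(euler h (i + m)).
set y := euler h (i + m).
have -> : y + h *: f y - euler h i - (m.+1%:R * h) *: v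
        = (y - euler h i - (m%:R * h) *: v) + h *: (f y - v).
  rewrite -natr1 mulrDl mul1r scalerDl scalerBr opprD !addrA.
  by rewrite [y + _ - _]addrAC [_ + h *: f y - _]addrAC.
rewrite (le_trans (ler_normD _ _))// -natr1 !mulrDl mul1r lerD//.
  by apply: IHm => j /andP[ij jm]; apply: fv; rewrite ij addnS ltnS ltnW.
rewrite normrZ ger0_norm// ler_wpM2l//; apply: fv.
by rewrite leq_addr addnS ltnSn.
Qed.

Context (M : R).
Hypothesis f_le : forall x, `|f x| <= M.

Lemma euler_lipschitz h i m : 0 <= h ->
  `|euler h (i + m) - euler h i| <= m%:R * h * M.
Proof.
move=> h0; have := @euler_increment h 0 M i m h0.
by rewrite scaler0 subr0; apply => j _; rewrite subr0.
Qed.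

End Euler.

Section Grid.
Context {R : realType}.
Implicit Types t : R.

Definition mesh (k : nat) : R := k.+1%:R^-1.

(** The index of the last grid point up to [t]. The Euler polygon is sampled
    there: the resulting step function has the same limit as the interpolated
    polygon, and needs no interpolation. *)
Definition node (k : nat) t : nat := Num.truncn (t * k.+1%:R).

Lemma mesh_gt0 k : 0 < mesh k.
Proof. by rewrite invr_gt0. Qed.

Lemma mesh_cvg0 : mesh k @[k --> \oo] --> (0 : R).
Proof. exact: cvg_harmonic. Qed.

Lemma node0 k : node k 0 = 0%N.
Proof. by rewrite /node mul0r truncn0. Qed.

Lemma node_bound k t : 0 <= t ->
  t - mesh k <= (node k t)%:R * mesh k <= t.
Proof.
move=> t0; have tk : 0 <= t * k.+1%:R by rewrite mulr_ge0.
have /andP[h1 h2] := truncn_itv tk; rewrite -/(node k t) in h1 h2.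
apply/andP; split; last by rewrite ler_pdivrMr.
rewrite lerBlDr -[X in _ + X]mul1r -mulrDl natr1 ler_pdivlMr//.
exact: ltW.
Qed.

Lemma node_homo k s t : s <= t -> (node k s <= node k t)%N.
Proof. by move=> st; apply: le_truncn; rewrite ler_wpM2r. Qed.

Lemma node_cvg t : 0 <= t -> (node k t)%:R * mesh k @[k --> \oo] --> t.
Proof.
move=> t0; apply: (@squeeze_cvgr _ \oo _ _ (fun k => t - mesh k) (fun=> t)).
- by near=> k; exact: node_bound.
- rewrite -[X in _ --> X]subr0; apply: cvgB; first exact: cvg_cst.
  exact: mesh_cvg0.
- exact: cvg_cst.
Unshelve. all: by end_near. Qed.

End Grid.

Section Peano.
Context {R : realType} {n : nat} (f : 'cV[R]_n.+1 -> 'cV[R]_n.+1).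
Context (x0 : 'cV[R]_n.+1) (M : R).
Hypothesis f_le : forall x, `|f x| <= M.
Hypothesis f_cont : continuous f.

Let xk (k : nat) (t : R) := euler f x0 (mesh k) (node k t).

(** The polygons are bounded at each time, so that every coordinate lies in a
    compact interval, where ultrafilters converge. *)
Lemma euler_ultralimit (U : set_system nat) : UltraFilter U -> \oo `<=` U ->
  exists x : R -> 'cV[R]_n.+1,
    forall t : R, 0 <= t -> xk k t @[k --> U] --> x t.
Proof.
move=> UU ooU; have PU : ProperFilter U by exact: ultra_proper.
suff ex (t : R) : exists y : 'cV[R]_n.+1, 0 <= t -> xk k t @[k --> U] --> y.
  by have [x xP] := choice ex; exists x.
have [t0|t0] := leP 0 t; last by exists 0.
have xk_entry (i : 'I_n.+1) : exists a : R, xk k t i 0 @[k --> U] --> a.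
  have : compact `[x0 i 0 - t * M, x0 i 0 + t * M] by exact: segment_compact.
  rewrite compact_ultra.
  move=> /(_ ((fun k => xk k t i 0) @ U)) /(_ (ultra_fmap _ UU)).
  case; last by move=> a [_ ?]; exists a.
  apply: ooU; exists 0%N => // k _; rewrite /= in_itv/= -ler_distl.
  have -> : xk k t i 0 - x0 i 0 = (xk k t - x0) i 0 by rewrite !mxE.
  apply: le_trans (mx_entry_le_norm _ _ _) _.
  have := euler_lipschitz x0 f_le 0 (node k t) (ltW (mesh_gt0 k)).
  rewrite add0n => /le_trans; apply; apply: ler_wpM2r.
    by apply: le_trans (f_le 0).
  by have /andP[] := node_bound k t0.
have [y yP] := choice xk_entry; exists (\col_i y i) => _.
by apply: mx_cvgP => i j; rewrite ord1 mxE; exact: yP.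
Qed.

Lemma euler_grid_increment k v eps s t : s <= t ->
  (forall j, (node k s <= j < node k t)%N ->
     `|f (euler f x0 (mesh k) j) - v| <= eps) ->
  `|xk k t - xk k s - ((node k t)%:R * mesh k - (node k s)%:R * mesh k) *: v|
    <= ((node k t)%:R * mesh k - (node k s)%:R * mesh k) * eps.
Proof.
move=> st fv; have Nst := node_homo k st.
have := @euler_increment _ _ f x0 (mesh k) v eps (node k s)
  (node k t - node k s) (ltW (mesh_gt0 k)).
by rewrite subnKC// natrB// mulrBl; exact.
Qed.

Lemma euler_dist h i j a m : 0 <= h ->
  (a <= i <= a + m)%N -> (a <= j <= a + m)%N ->
  `|euler f x0 h i - euler f x0 h j| <= m%:R * h * M.
Proof.
move=> h0; wlog ij : i j / (i <= j)%N.
  have [ij|/ltnW ij] := leqP i j; first exact.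
  by move=> wl ai aj; rewrite distrC; exact: wl.
move=> /andP[ai _] /andP[_ jm]; rewrite distrC -(subnKC ij).
apply: le_trans (euler_lipschitz x0 f_le i (j - i) h0) _.
have M0 : 0 <= M by apply: le_trans (f_le 0).
apply: ler_wpM2r => //; apply: ler_wpM2r => //.
by rewrite ler_nat leq_subLR (leq_trans jm)// leq_add2r.
Qed.

(** The estimate behind the differential equation: on a short interval around
    [c] the polygons stay where [f] is within [eps] of [v]; the bound for the
    increments of the polygons survives in the limit. *)
Lemma limit_increment (U : set_system nat) (x : R -> 'cV[R]_n.+1)
    (c s t : R) v (eps delta : R) :
  ProperFilter U -> \oo `<=` U ->
  (forall t : R, 0 <= t -> xk k t @[k --> U] --> x t) ->
  0 <= s -> s <= c <= t -> 0 < delta -> (t - s) * M < delta / 2 ->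
  (forall z, `|z - x c| < delta -> `|f z - v| <= eps) ->
  `|x t - x s - (t - s) *: v| <= (t - s) * eps.
Proof.
move=> PU ooU xlim s0 /andP[sc ct] delta0 tsM fv.
have c0 := le_trans s0 sc; have t0 := le_trans c0 ct.
have Ncvg (u : R) : 0 <= u -> (node k u)%:R * mesh k @[k --> U] --> u.
  by move=> u0; apply: cvg_trans (node_cvg u0); exact: cvg_app.
have Ncvg2 :
    (node k t)%:R * mesh k - (node k s)%:R * mesh k @[k --> U] --> t - s.
  by apply: cvgB; exact: Ncvg.
apply: (@ler_cvg_to _ U _ _
  (fun k => `|xk k t - xk k s
    - ((node k t)%:R * mesh k - (node k s)%:R * mesh k) *: v|)
  (fun k => ((node k t)%:R * mesh k - (node k s)%:R * mesh k) * eps)).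
- apply: cvg_norm; apply: cvgB; first by apply: cvgB; exact: xlim.
  by apply: cvgZr_tmp.
- by apply: cvgMl.
have delta2 : 0 < delta / 2 by rewrite divr_gt0.
have xc := @cvgr_dist_lt _ _ _ U _ _ _ (xlim c c0) _ delta2.
near=> k; apply: euler_grid_increment; first exact: le_trans ct.
move=> j /andP[sj jt]; apply: fv.
rewrite (splitr delta) -(subrKA (xk k c)) (le_lt_trans (ler_normD _ _))//.
apply: ltrD; last by rewrite distrC; near: k; exact: xc.
have Nst := node_homo k (le_trans sc ct).
apply: (@le_lt_trans _ _
  (((node k t)%:R * mesh k - (node k s)%:R * mesh k) * M)).
  rewrite -mulrBl -natrB//; apply: (@euler_dist _ _ _ (node k s)).
  - exact: ltW (mesh_gt0 k).
  - by rewrite sj subnKC// ltnW.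
  - by rewrite subnKC// !node_homo.
near: k; apply: cvgr_lt tsM; exact: cvgMl.
Unshelve. all: by end_near. Qed.

(** Peano's theorem for a bounded field: the Euler polygons converge pointwise
    along a free ultrafilter, which replaces the extraction of a uniformly
    convergent subsequence. *)
Lemma peano_bounded : exists x, is_solution f x0 x.
Proof.
have [U [UU ooU]] := @ultraFilterLemma nat \oo _.
have PU : ProperFilter U by exact: ultra_proper.
have [x xlim] := euler_ultralimit UU ooU.
have M0 : 0 <= M by apply: le_trans (f_le 0).
(* With [v = 0] and [eps = M] the closeness condition of [limit_increment] holds
   everywhere, so that any large [delta] will do. *)
have lip s t : 0 <= s -> s <= t -> `|x t - x s| <= (t - s) * M.
  move=> s0 st; rewrite -[x t - x s]subr0 -(scaler0 _ (t - s)).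
  have delta0 : 0 < 2 * ((t - s) * M + 1).
    by rewrite mulr_gt0// ltr_wpDl// mulr_ge0// subr_ge0.
  apply: (@limit_increment U x s s t 0 M _ PU ooU xlim s0 _ delta0).
  - by rewrite lexx.
  - by rewrite mulrAC mulfV// mul1r ltrDl.
  - by move=> z _; rewrite subr0.
have lip' s t : 0 <= s -> 0 <= t -> `|x s - x t| <= `|s - t| * M.
  move=> s0 t0; have [st|/ltW ts] := leP s t.
    by rewrite distrC (distrC s) [`|t - s|]ger0_norm ?subr_ge0// lip.
  by rewrite [`|s - t|]ger0_norm ?subr_ge0// lip.
exists x; split.
- apply: (@norm_cvg_unique _ _ (xk k 0 @[k --> U])); first exact: xlim.
  have -> : xk^~ 0 = fun=> x0 by apply/funext => k; rewrite /xk node0.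
  exact: cvg_cst.
- apply/subspace_continuousP => s; rewrite /= in_itv/= andbT => s0.
  apply/cvgrPdist_lt => e e0.
  have eM : 0 < e / (M + 1) by rewrite divr_gt0// ltr_wpDl.
  rewrite near_withinE; near=> u; rewrite /= in_itv/= andbT => u0.
  rewrite (le_lt_trans (lip' _ _ s0 u0))//.
  have : `|s - u| < e / (M + 1) by near: u; exact: cvgr_dist_lt.
  rewrite ltr_pdivlMr; last by rewrite ltr_wpDl.
  by apply: le_lt_trans; rewrite ler_wpM2l// lerDl.
move=> t t0.
have dcvg :
    h^-1 *: ((x \o shift t) (h *: (1 : R)) - x t) @[h --> 0^'] --> f (x t).
  apply/cvgrPdist_le => e e0.
  have /cvgrPdist_lt /(_ _ e0) := @f_cont (x t).
  rewrite -nbhs_nearE => /nbhs_normP[d /= d0 dP].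
  have fv z : `|z - x t| < d -> `|f z - f (x t)| <= e.
    by move=> zd; rewrite distrC ltW//; apply: dP; rewrite /ball_/= distrC.
  have dM : 0 < d / 2 / (M + 1) by rewrite !divr_gt0// ltr_wpDl.
  near=> h.
  have h0 : h != 0 by near: h; exact: nbhs_dnbhs_neq.
  have ht : `|h| < t by near: h; exact: dnbhs0_lt.
  have hM : `|h| * M < d / 2.
    have : `|h| < d / 2 / (M + 1) by near: h; exact: dnbhs0_lt.
    rewrite ltr_pdivlMr; last by rewrite ltr_wpDl.
    by apply: le_lt_trans; rewrite ler_wpM2l// lerDl.
  rewrite /= /shift /= /GRing.scale /= mulr1.
  have key : `|x (h + t) - x t - h *: f (x t)| <= `|h| * e.
    have [hp|hn] := leP 0 h.
      have := @limit_increment U x t t (h + t) (f (x t)) e d PU ooU xlim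
        (ltW t0).
      rewrite addrK lexx lerDr hp (ger0_norm hp); apply => //.
      by rewrite -(ger0_norm hp).
    have th0 : 0 <= h + t by move: ht; rewrite ltr0_norm//; lra.
    have := @limit_increment U x t (h + t) t (f (x t)) e d PU ooU xlim th0.
    rewrite opprD addrCA subrr addr0 lexx gerDr (ltW hn) (ltr0_norm hn).
    rewrite scaleNr opprK -normrN opprD opprB; apply => //.
    by rewrite -(ltr0_norm hn).
  rewrite distrC -(@ler_pM2l _ `|h|) ?normr_gt0//.
  rewrite -normrZ scalerBr scalerA mulfV// scale1r.
  exact: key.
split; first by apply/cvg_ex; exists (f (x t)).
by apply: cvg_lim.
Unshelve. all: by end_near. Qed.

End Peano.

Section DissipativeField.
Context {R : realType} {n : nat}.
Implicit Types (x : R -> 'cV[R]_n.+1) (y v xs : 'cV[R]_n.+1).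

Lemma is_derive_entry x v t i :
  is_derive t (1 : R) x v -> is_derive t (1 : R) (fun s => x s i 0) (v i 0).
Proof.
move=> [dx xv]; split; first by have /derivable_mxP := dx; exact.
by move: xv; rewrite derive_mx// => <-; rewrite mxE.
Qed.

Lemma is_derive_half_sqr_dist x v xs t : is_derive t (1 : R) x v ->
  is_derive t (1 : R) (fun s => 2^-1 * norm2 (x s - xs) ^+ 2)
    (dot (x t - xs) v).
Proof.
move=> dx.
pose h i := (fun s : R => x s i 0 - xs i 0).
have dh i : is_derive t (1 : R) (h i) (v i 0).
  rewrite -[v i 0]subr0.
  exact: (is_deriveB (is_derive_entry i dx) (is_derive_cst (xs i 0) t 1)).
have dhh i : is_derive t (1 : R) (h i * h i) (2 * (h i t * v i 0)).
  rewrite [2 * _](_ : _ = h i t *: v i 0 + h i t *: v i 0).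
    exact: is_deriveM.
  by rewrite /GRing.scale/=; ring.
have := is_deriveZ (2^-1 : R) (is_derive_sum dhh).
have -> : 2^-1 \*: \sum_(i < n.+1) h i * h i
        = fun s => 2^-1 * norm2 (x s - xs) ^+ 2.
  apply/funext => s; rewrite norm2_sqr dotE /GRing.scale/= fct_sumE.
  congr (_ * _).
  by apply: eq_bigr => i _; rewrite !mxE.
rewrite -mulr_sumr scalerA mulVf// scale1r dotE.
by under [X in _ -> is_derive _ _ _ X]eq_bigr do rewrite !mxE.
Qed.

Lemma half_sqr_dist_continuous xs :
  continuous (fun y : 'cV[R]_n.+1 => 2^-1 * norm2 (y - xs) ^+ 2).
Proof.
move=> y; under eq_fun do rewrite expr2.
have ny : (fun z : 'cV[R]_n.+1 => norm2 (z - xs)) z @[z --> y]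
    --> norm2 (y - xs).
  apply: (@continuous_comp _ _ _ (fun y : 'cV[R]_n.+1 => y - xs) (@norm2 R _)).
    apply: (@cvgB _ _ _ _ (nbhs_filter y)); first exact: cvg_id.
    exact: cvg_cst.
  exact: norm2_continuous.
apply: (@cvgM _ _ _ (nbhs_filter y)); first exact: cvg_cst.
exact: (@cvgM _ _ _ (nbhs_filter y)).
Qed.

Lemma half_sqr_dist_within x xs : {within `[0, +oo[, continuous x} ->
  {within `[0, +oo[, continuous (fun s => 2^-1 * norm2 (x s - xs) ^+ 2)}.
Proof.
move=> /subspace_continuousP cx; apply/subspace_continuousP => t t0.
apply: (@cvg_comp _ _ _ x (fun y => 2^-1 * norm2 (y - xs) ^+ 2) _ (nbhs (x t))).
  exact: cx.
exact: half_sqr_dist_continuous.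
Qed.

Context (f : 'cV[R]_n.+1 -> 'cV[R]_n.+1) (xs : 'cV[R]_n.+1).
Hypothesis f_diss : forall y, dot (y - xs) (f y) <= 0.

Lemma solution_dist_decr (x0 : 'cV[R]_n.+1) x : is_solution f x0 x ->
  forall t, 0 <= t -> norm2 (x t - xs) <= norm2 (x0 - xs).
Proof.
move=> [xx0 cx dx] t t0.
have := derive_le0_decr (half_sqr_dist_within (xs := xs) cx)
  (dV := fun t => dot (x t - xs) (f (x t))).
move=> /(_ _ 0 t); rewrite lexx t0 => /(_ _ isT).
rewrite ler_pM2l ?invr_gt0// ler_sqr ?nnegrE ?norm2_ge0// -xx0; apply=> s s0.
by split; [exact: is_derive_half_sqr_dist (dx s s0)|exact: f_diss].
Qed.

End DissipativeField.

(** Solutions cannot leave the ball around [xs] through [x0].  On this compact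
    ball [f] has a bound, at which it is truncated radially;
    the truncated field is dissipative too and thus confined to the same ball,
    where it coincides with [f]. *)
Lemma peano_dissipative (R : realType) n (f : 'cV[R]_n.+1 -> 'cV[R]_n.+1) xs :
  continuous f -> (forall y, dot (y - xs) (f y) <= 0) ->
  forall x0, exists x, is_solution f x0 x.
Proof.
move=> f_cont f_diss x0.
pose r := norm2 (x0 - xs).
have [B fB] : exists B, forall y, norm2 (y - xs) <= r -> `|f y| <= B.
  have ball_compact :
      compact [set v : 'rV[R]_n.+1 | [set c | c <= r] (norm2 (v^T - xs))].
    by apply: (norm2_preimage_compact (r := r)) => //; exact: closed_le.
  have fT_cont : continuous (fun v : 'rV[R]_n.+1 => `|f v^T|).
    move=> v; apply: (@cvg_norm _ _ _ _ (nbhs_filter v)).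
    apply: (@continuous_comp _ _ _ (fun v : 'rV[R]_n.+1 => v^T) f).
      exact: trmx_continuous.
    exact: f_cont.
  have [|v _ vmax] := EVT_max_rV _ ball_compact (continuous_subspaceT fT_cont).
    by exists x0^T; rewrite /= trmxK.
  exists `|f v^T| => y yr; rewrite -(trmxK y); apply: vmax.
  by rewrite inE/= trmxK.
pose M := Num.max 1 B.
have M0 : 0 < M by rewrite lt_max ltr01.
pose g y := (M / Num.max M `|f y|) *: f y.
have max_gt0 y : 0 < Num.max M `|f y| by rewrite lt_max M0.
have g_le y : `|g y| <= M.
  rewrite /g normrZ ger0_norm; last by rewrite divr_ge0 ?ltW.
  by rewrite -mulrA ler_piMr ?(ltW M0)// ler_pdivrMl// mulr1 le_max lexx orbT.
have g_cont : continuous g.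
  move=> y; apply: (@cvgZ _ _ _ _ (nbhs_filter y)); last exact: f_cont.
  apply: (@cvgM _ _ _ (nbhs_filter y)); first exact: cvg_cst.
  apply: (@cvgV _ _ _ (nbhs_filter y)); first by rewrite gt_eqF.
  apply: (@continuous_max R _ (fun=> M) (fun y => `|f y|)).
    exact: cst_continuous.
  by apply: (@cvg_norm _ _ _ _ (nbhs_filter y)); exact: f_cont.
have g_diss y : dot (y - xs) (g y) <= 0.
  by rewrite /g dotZr mulr_ge0_le0// divr_ge0 ?ltW.
have [x xsol] := peano_bounded x0 g_le g_cont.
exists x; have [xx0 cx dx] := xsol; split=> // t t0.
have <- : g (x t) = f (x t); last exact: dx.
have xtr := solution_dist_decr g_diss xsol (ltW t0).
rewrite /g max_l ?mulfV ?gt_eqF ?scale1r//.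
by rewrite le_max fB// orbT.
Qed.

(** * The vector field *)

Lemma powR_cvg0_ge0 (R : realType) (T : Type) (F : set_system T) {FF : Filter F}
    (u : T -> R) (k : R) :
  0 < k -> (forall t, 0 <= u t) -> u t @[t --> F] --> 0 ->
  u t `^ k @[t --> F] --> 0.
Proof.
move=> k0 u0 ucvg; apply/cvgrPdist_le => e e0.
have /cvgrPdist_le /(_ _ (powR_gt0 k^-1 e0)) := ucvg.
apply: filterS => t; rewrite !sub0r !normrN !ger0_norm ?powR_ge0// => ut.
rewrite -[leRHS](powRr1 (ltW e0)) -(mulVf (lt0r_neq0 k0)) powRrM.
by apply: ge0_ler_powR; rewrite ?nnegrE ?powR_ge0 ?(ltW k0).
Qed.

Section FieldContinuity.
Context {R : realType} {n : nat} (A : 'M[R]_n.+1) (b xs : 'cV[R]_n.+1).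
Context (rho1 rho2 gamma lam1 lam2 : R).
Hypothesis sigma_gt1 : 1 < sigma_min A.
Hypothesis residual_xs : residual A b xs = 0.
Hypotheses (rho1_gt0 : 0 < rho1) (rho2_gt0 : 0 < rho2) (gamma_gt0 : 0 < gamma).
Hypotheses (lam1_gt0 : 0 < lam1) (lam2_gt0 : 0 < lam2).
Let f x := ave_rho A b rho1 rho2 lam1 lam2 x *: ave_g A b gamma x.
Let N x := norm2 (residual A b x).

Lemma absv_continuous : continuous (@absv R n.+1).
Proof.
move=> x; apply: (@mx_cvgP _ _ _ (nbhs_filter x)) => i j; rewrite mxE.
under eq_fun do rewrite mxE.
by apply: (@cvg_norm _ _ _ _ (nbhs_filter x)); exact: coord_continuous.
Qed.

Lemma residual_continuous : continuous (residual A b).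
Proof.
move=> x; apply: (@cvgB _ _ _ _ (nbhs_filter x)); last exact: cvg_cst.
apply: (@cvgB _ _ _ _ (nbhs_filter x)); first exact: mulmx_continuous.
exact: absv_continuous.
Qed.

Lemma norm2_residual_continuous : continuous N.
Proof.
move=> x; apply: (@continuous_comp _ _ _ (residual A b) (@norm2 R _)).
  exact: residual_continuous.
exact: norm2_continuous.
Qed.

(** Where the residual vanishes, so do both sides, because of [ave_g]. *)
Lemma ave_fieldE x :
  f x = (rho1 / N x `^ (1 - lam1) + rho2 / N x `^ (1 - lam2))
        *: ave_g A b gamma x.
Proof.
rewrite /f /ave_rho; case: eqVneq => // r0.
by rewrite ave_g_residual r0 mulmx0 !scaler0.
Qed.

(** The exponents [lam - 1] of [ave_rho] exceed [-1], so that the factor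
    [residual] of [ave_g] compensates the singularity at the equilibrium. *)
Lemma ave_field_le x : `|f x| <=
  gamma * spectral_norm A^T * (rho1 * N x `^ lam1 + rho2 * N x `^ lam2).
Proof.
have N0 : 0 <= N x := norm2_ge0 _.
have NN l : N x / N x `^ (1 - l) <= N x `^ l.
  have [->|Nx] := eqVneq (N x) 0; first by rewrite mul0r powR_ge0.
  rewrite -{1}(powRr1 N0) -powRB ?Nx ?implybT//.
  by rewrite (_ : 1 - (1 - l) = l)//; ring.
have rho_ge0 : 0 <= rho1 / N x `^ (1 - lam1) + rho2 / N x `^ (1 - lam2).
  by rewrite addr_ge0// divr_ge0 ?powR_ge0 ?(ltW rho1_gt0) ?(ltW rho2_gt0).
have g_le : `|ave_g A b gamma x| <= gamma * (spectral_norm A^T * N x).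
  rewrite ave_g_residual normrZ normrN (ger0_norm (ltW gamma_gt0)).
  apply: ler_wpM2l; first exact: ltW.
  apply: le_trans (spectral_normP A^T (residual A b x)).
  by apply: mx_norm_le (norm2_ge0 _) _ => i j; rewrite ord1 norm2_coord.
have K0 : 0 <= spectral_norm A^T.
  have [v v1] := @norm2_sphere_nonempty R n.
  have := spectral_normP A^T v; rewrite v1 mulr1.
  exact: le_trans (norm2_ge0 _).
rewrite ave_fieldE normrZ ger0_norm//.
apply: le_trans (ler_wpM2l rho_ge0 g_le) _.
rewrite mulrCA -mulrA ler_wpM2l ?(ltW gamma_gt0)// mulrCA ler_wpM2l//.
rewrite mulrDl lerD// mulrAC -mulrA.
  by rewrite ler_wpM2l ?(ltW rho1_gt0).
by rewrite ler_wpM2l ?(ltW rho2_gt0).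
Qed.

(** Away from [xs] every ingredient is continuous; at [xs] the bound of
    [ave_field_le] tends to [0]. *)
Lemma ave_field_continuous : continuous f.
Proof.
move=> x; have [->|xxs] := eqVneq x xs.
  have N_xs : N xs = 0 by rewrite /N residual_xs norm2_0.
  have f_xs : f xs = 0.
    by rewrite ave_fieldE ave_g_residual residual_xs mulmx0 !scaler0.
  suff f0 : `|f y| @[y --> xs] --> (0 : R).
    have : f y @[y --> xs] --> (0 : 'cV[R]_n.+1).
      exact: (@norm_cvg0 _ _ _ _ (nbhs_filter xs)).
    by rewrite -f_xs.
  apply: (@squeeze_cvgr _ _ (nbhs_filter xs) _ (fun=> 0)
    (fun x => gamma * spectral_norm A^T
                * (rho1 * N x `^ lam1 + rho2 * N x `^ lam2))).
  - by apply: nearW => y; rewrite normr_ge0 ave_field_le.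
  - exact: cvg_cst.
  have Ncvg0 k : 0 < k -> N y `^ k @[y --> xs] --> 0.
    move=> k0; apply: (@powR_cvg0_ge0 _ _ _ (nbhs_filter xs)) => //.
      by move=> y; exact: norm2_ge0.
    by rewrite -[X in _ --> X]N_xs; exact: norm2_residual_continuous.
  have h1 := Ncvg0 _ lam1_gt0; have h2 := Ncvg0 _ lam2_gt0.
  rewrite -[X in _ --> X](_ : gamma * spectral_norm A^T
    * (rho1 * 0 + rho2 * 0) = 0); last by ring.
  apply: (@cvgMr _ _ _ (nbhs_filter xs)).
  by apply: (@cvgD _ _ _ _ (nbhs_filter xs));
    exact: (@cvgMr _ _ _ (nbhs_filter xs)).
have Nx : 0 < N x by rewrite norm2_gt0 (residual_eq0 sigma_gt1 residual_xs).
rewrite (_ : f = fun x => (rho1 / N x `^ (1 - lam1)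
  + rho2 / N x `^ (1 - lam2)) *: ave_g A b gamma x); last first.
  by apply/funext => y; rewrite ave_fieldE.
have Ncvg k : N y `^ k @[y --> x] --> N x `^ k.
  apply: (@continuous_comp _ _ _ N (fun a => a `^ k)).
    exact: norm2_residual_continuous.
  exact: powR_continuous.
have rcvg rho k : rho / N y `^ k @[y --> x] --> rho / N x `^ k.
  apply: (@cvgMr _ _ _ (nbhs_filter x)).
  apply: (@cvgV _ _ _ (nbhs_filter x)) => //.
  by rewrite gt_eqF// powR_gt0.
apply: (@cvgZ _ _ _ _ (nbhs_filter x)).
  by apply: (@cvgD _ _ _ _ (nbhs_filter x)).
rewrite (_ : ave_g A b gamma = fun y => - gamma *: (A^T *m residual A b y)).
  apply: (@cvgZl_tmp _ _ _ _ (nbhs_filter x)).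
  apply: (@continuous_comp _ _ _ (residual A b) (mulmx A^T)).
    exact: residual_continuous.
  exact: mulmx_continuous.
by apply/funext => y; rewrite ave_g_residual.
Qed.

End FieldContinuity.

Theorem theorem3p3 (R : realType) (n : nat) (A : 'M[R]_n.+1)
    (b xs : 'cV[R]_n.+1) (rho1 rho2 gamma lam1 lam2 : R)
    (hA : A \in unitmx) (hAinv : spectral_norm (invmx A) < 1)
    (hrho1 : 0 < rho1) (hrho2 : 0 < rho2) (hgamma : 0 < gamma)
    (hlam1 : 0 < lam1 < 1) (hlam2 : 1 < lam2)
    (hxs : unique (fun x : 'cV[R]_n.+1 => A *m x - absv x - b = 0) xs) :
  let L1 := spectral_norm (A + 1%:M) in
  let L2 := spectral_norm (A - 1%:M) in
  let mu := sigma_min A ^+ 2 - 1 in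
  let kappa1 := (lam1 + 1) / 2 in
  let kappa2 := (lam2 + 1) / 2 in
  let c1 := 2 `^ ((lam1 - 1) / 2) * gamma * rho1 * mu ^+ 2
            / (L1 + L2) `^ (3 - lam1) in
  let c2 := 2 `^ ((lam2 - 1) / 2) * gamma * rho2 * mu `^ (1 + lam2)
            / (L1 + L2) `^ (1 + lam2) in
  let Tmax := 1 / (c1 * (1 - kappa1)) + 1 / (c2 * (kappa2 - 1)) in
  [/\ 0 < mu, 0 < c1, 0 < c2, 1 / 2 < kappa1 < 1 & 1 < kappa2] /\
  exists T : 'cV[R]_n.+1 -> R,
    globally_fixed_time_stable
      (fun x => ave_rho A b rho1 rho2 lam1 lam2 x *: ave_g A b gamma x)
      xs T Tmax.
Proof.
move=> L1 L2 mu kappa1 kappa2 c1 c2 Tmax.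
have [residual_xs _] := hxs.
have {}residual_xs : residual A b xs = 0 by [].
have sigma_gt1 := sigma_min_gt1 hA hAinv.
have /andP[lam1_gt0 lam1_lt1] := hlam1.
have mu0 : 0 < mu := sigma_min_sqrB1_gt0 sigma_gt1.
have L0 : 0 < L1 + L2 by apply: lt_le_trans (spectral_norm_sum_ge2 A).
have c1_gt0 : 0 < c1 by rewrite /c1 divr_gt0 ?mulr_gt0 ?powR_gt0 ?exprn_gt0.
have c2_gt0 : 0 < c2 by rewrite /c2 divr_gt0 ?mulr_gt0 ?powR_gt0 ?exprn_gt0.
have kappa1_itv : 1 / 2 < kappa1 < 1 by rewrite /kappa1; lra.
have kappa2_gt1 : 1 < kappa2 by rewrite /kappa2; lra.
have /andP[_ kappa1_lt1] := kappa1_itv.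
split=> //; exists (fun=> Tmax).
set f := fun x => _.
have f_decay := ave_field_decay sigma_gt1 residual_xs hrho1 hrho2 hgamma
  lam1_gt0 lam1_lt1 hlam2.
have f_diss y : dot (y - xs) (f y) <= 0.
  apply: le_trans (f_decay y) _; rewrite oppr_le0.
  apply: addr_ge0; (apply: mulr_ge0; last exact: powR_ge0).
    exact: ltW c1_gt0.
  exact: ltW c2_gt0.
have f_cont : continuous f.
  exact: (ave_field_continuous sigma_gt1 residual_xs hrho1 hrho2 hgamma
    lam1_gt0 (lt_trans ltr01 hlam2)).
have Tmax_gt0 : 0 < Tmax.
  by rewrite addr_gt0// divr_gt0// mulr_gt0// subr_gt0.
have settled x0 x : is_solution f x0 x -> forall t : R, Tmax <= t -> x t = xs.
  move=> [xx0 cx dx] t tT.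
  suff : 2^-1 * norm2 (x t - xs) ^+ 2 = 0.
    move=> /eqP; rewrite mulf_eq0 invr_eq0 pnatr_eq0/= sqrf_eq0 norm2_eq0.
    by rewrite subr_eq0 => /eqP.
  apply: (@fixed_time_decay R (fun s => 2^-1 * norm2 (x s - xs) ^+ 2)
    (fun s => dot (x s - xs) (f (x s))) c1 c2 kappa1 kappa2
    c1_gt0 c2_gt0 kappa1_lt1 kappa2_gt1) tT => [s _||s s0].
  - by rewrite mulr_ge0 ?invr_ge0 ?sqr_ge0.
  - exact: half_sqr_dist_within.
  - by split; [exact: is_derive_half_sqr_dist (dx s s0)|exact: f_decay].
split=> //; split;
  last by split=> [x0|x0 x xsol]; [exact: ltW|exact: settled xsol].
- by rewrite /equilibrium /f ave_g_residual residual_xs mulmx0 !scaler0.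
- split; first exact: peano_dissipative f_diss.
    move=> eps eps0; exists eps => // x0 x xsol x0eps t t0.
    exact: le_lt_trans (solution_dist_decr f_diss xsol t0) x0eps.
  move=> x0 x xsol; apply: cvg_near_cst; near=> t.
  by apply: settled xsol _ _; near: t; exact: nbhs_pinfty_ge (num_real _).
Unshelve. all: by end_near. Qed.
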